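(* There exists an absolute constant $c>0$ such that the following holds. Let $q\ge2$ be a real number and let $d<\min\left(e^{cq},\frac{n}{q+1}\right)$ be an integer. Let $\chi$ be an irreducible character of $S_n$ of level $d$. Then $$\|\chi\|_q\ge\left(\frac{cq}{\log(qd)}\right)^{d}\left(\frac{d^{d}\chi(1)}{n^{d}}\right)^{1-2/q}.$$
   Context: $S_n$ is the symmetric group on $n$ letters, and irreducible characters are the complex irreducible characters $\chi_\lambda$ indexed by partitions $\lambda=(\lambda_1\ge\lambda_2\ge\cdots)$ of $n$. Write $\lambda'$ for the conjugate partition (transposed Young diagram), so $\lambda_1'$ is the number of parts of $\lambda$. The level of $\chi_\lambda$ is $\min(n-\lambda_1,\,n-\lambda_1')$. For a function $f$ on $S_n$, $\|f\|_q=\big(\frac{1}{n!}\sum_{\sigma\in S_n}|f(\sigma)|^q\big)^{1/q}$. The logarithm is natural. When $d=0$, all $d$-th powers are interpreted as $1$ (including $0^0=1$). *)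

(* Defs.v *)
From HB Require Import structures.
From mathcomp Require Import all_boot all_order all_algebra all_fingroup.
From mathcomp Require Import all_field all_character.
From mathcomp Require Import all_classical all_reals all_analysis.
Set Implicit Arguments.
Unset Strict Implicit.
Unset Printing Implicit Defensive.
Import Order.TTheory GRing.Theory Num.Theory.
Local Open Scope ring_scope.

Definition is_partition_of (n : nat) (l : seq nat) : bool :=
  [&& sorted geq l, all (fun k => 0 < k)%N l & sumn l == n].

Definition conj_partition (l : seq nat) : seq nat :=
  mkseq (fun j => count (fun k => j < k)%N l) (head 0%N l).

Definition partition_level (n : nat) (l : seq nat) : nat :=
  minn (n - head 0 l) (n - head 0 (conj_partition l)).

(* Rows and columns refer to the tableau of shape l filled with 0, ..., n-1
   row by row from left to right: the entry i lies in row [reshape_index l i]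
   and column [reshape_offset l i]. *)
Definition row_stabilizer (n : nat) (l : seq nat) : {set 'S_n} :=
  [set s : 'S_n | [forall i, reshape_index l (s i) == reshape_index l i]].

Definition col_stabilizer (n : nat) (l : seq nat) : {set 'S_n} :=
  [set s : 'S_n | [forall i, reshape_offset l (s i) == reshape_offset l i]].

(* The Young symmetrizer, as a row vector of the (right) regular
   representation; [gring_row] maps the matrix of a group ring element to its
   coordinates on the basis of group elements. *)
Definition young_symmetrizer (n : nat) (l : seq nat) :
    'rV[algC]_#|[set: 'S_n]| :=
  let aG := regular_repr algC [set: 'S_n] in
  gring_row ((\sum_(s in row_stabilizer n l) aG s) *m
             (\sum_(s in col_stabilizer n l) (-1) ^+ s *: aG s)).

(* The character of the Specht module of shape l, realised as the right ideal
   of the group algebra generated by the Young symmetrizer.  This is the usual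
   labelling: [:: n] gives the trivial character and nseq n 1 the sign. *)
Definition specht_character (n : nat) (l : seq nat) : 'CF([set: 'S_n]) :=
  cfRepr (submod_repr
    (cyclic_mx_module (regular_repr algC [set: 'S_n]) (young_symmetrizer n l))).

Definition has_level (n : nat) (chi : 'CF([set: 'S_n])) (d : nat) : Prop :=
  exists l : seq nat,
    [/\ is_partition_of n l, chi = specht_character n l
      & d = partition_level n l].

(* The embedding into R of the real elements of algC, by Dedekind cuts; it is
   only meaningful on real arguments. *)
Definition real_of_algC (R : realType) (x : algC) : R :=
  sup [set (ratr r : R) | r in [set r : rat | (ratr r : algC) <= x]]%classic.

Definition character_Lnorm (R : realType) (n : nat) (q : R)
    (chi : 'CF([set: 'S_n])) : R :=
  ((n`!%:R)^-1 * \sum_(s : 'S_n) real_of_algC R `|chi s| `^ q) `^ q^-1.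

(* Main.v *)
Require Import Defs.
From HB Require Import structures.
From mathcomp Require Import all_boot all_order all_algebra all_fingroup.
From mathcomp Require Import all_field all_character.
From mathcomp Require Import all_classical all_reals all_analysis.
From mathcomp Require Import zify ring lra.
Set Implicit Arguments.
Unset Strict Implicit.
Unset Printing Implicit Defensive.
Import Order.TTheory GRing.Theory Num.Theory.
Local Open Scope ring_scope.

(** Permutations with many fixed points force the lower bound.  Let [chi] have
   level [d] and degree [m], and let [X s] be the number of [k]-sets of points
   fixed by [s].  Two estimates of the sum of [X s * |chi s|] are compared.

   From below, [X] decomposes the sum over the pointwise stabilizers of the
   [k]-sets [K].  On one of them the sum of [|chi|] is at least its order times
   the multiplicity, in the restriction of [chi], of a character [th] that is
   trivial when [d = n - l_1] and the sign when [d = n - l'_1].  The module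
   of [chi] contains a nonzero vector on which the stabilizer of some [d]-set
   acts by [th]; by irreducibility the translates [W_D] of the space of these
   vectors, [D] running over the [d]-sets, span the module.  A basis taken
   greedily from the [W_D] shows that on average over [K] the multiplicity is
   at least [m 'C(n - d, k - d) / 'C(n, k)]
   ([mxrank_modular_weights], [sum_binom_fixpoints_char_ge]).

   From above, the first two moments of [X] are at most [1 / k!] and
   [2^k / k!], and Hoelder's inequality with the exponents [q], [q / (q - 2)]
   and [q] ([hoelder_sum_square]) is applied to [|chi|], [X^(1 - 2/q)] and
   [X^(2/q)].  Together these give [character_Lnorm_ge]:
      [m k^_d <= N (k! 2^k)^(1/q) n^_d]   for [d <= k <= n],
   [N] being the norm to be bounded.

   Take [k] to be about [q d / log(q d)], but at least [d]: then
   [(k! 2^k)^(1/q) <= 4^d], while [(k / n)^d m] is the claimed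
   quantity up to a factor [C^d], with exponent [1] in place of [1 - 2/q].
   The exponent costs only another [2^d] because [m >= 'C(n - d, d)], hence
   [d^d m / n^d >= 2^-d].  The degree bound comes from an identity submatrix in
   the matrix of right translates of the Young symmetrizer
   ([rank_cyclic_symmetrizer]). *)

(** * Counting fixed points of permutations *)

Section Fix.
(* finite sets, rather than classical sets, give their meaning to shared names *)
Import boot.fintype boot.finset.
Variable T : finType.
Implicit Types (s : {perm T}) (A K L : {set T}).

Definition fixpoints s : {set T} := [set x | s x == x].

Lemma perm_on_fixpoints A s : perm_on A s = (~: A \subset fixpoints s).
Proof.
rewrite /perm_on; apply/idP/idP => /subsetP h; apply/subsetP => x.
  by rewrite !inE => xA; apply: contraNT xA => /h.
by rewrite !inE; apply: contraNT => xA; have := h x; rewrite !inE xA; apply.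
Qed.

(** Double counting of pairs (a set of [k] points of [A], a permutation fixing it pointwise). *)
Lemma sum_binom_fixpoints (V : nmodType) k A (P : pred {perm T}) (g : {perm T} -> V) :
  \sum_(s | P s) g s *+ 'C(#|A :&: fixpoints s|, k) =
  \sum_(L : {set T} | (L \subset A) && (#|L| == k))
     \sum_(s | P s && perm_on (~: L) s) g s.
Proof.
under [RHS]eq_bigr do rewrite big_mkcondr.
rewrite exchange_big /=; apply: eq_bigr => s _.
rewrite -big_mkcondr sumr_const -cards_draws; congr (_ *+ _).
apply: eq_card => L; rewrite !inE /= [RHS]unfold_in perm_on_fixpoints setCK subsetI.
by rewrite andbAC.
Qed.

Lemma sum_binom_fixpoints_perm_on A k :
  (\sum_(s : {perm T} | perm_on A s) 'C(#|A :&: fixpoints s|, k) =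
  'C(#|A|, k) * (#|A| - k)`!)%N.
Proof.
transitivity (\sum_(s : {perm T} | perm_on A s) (1%N : nat) *+ 'C(#|A :&: fixpoints s|, k))%R.
  by apply: eq_bigr => s _; rewrite -[LHS]natn.
rewrite sum_binom_fixpoints -cards_draws -sum_nat_const.
apply: eq_big => [L|L /andP[sLA /eqP Lk]]; first by rewrite inE.
rewrite -Lk -cardsDS // -card_perm -sum1_card; apply: eq_bigl => s.
rewrite [RHS](perm_on_fixpoints (A :\: L) s) !perm_on_fixpoints setCK.
by rewrite setDE setCI setCK subUset.
Qed.

(** Expand one factor over the fixed [k]-sets [K] and the other, by Vandermonde's
   identity, over the fixed points inside and outside [K]: outside, each of the
   [2 ^ k] choices inside [K] contributes at most [(n - k)!]. *)
Lemma sum_binom_fixpoints2 k :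
  (\sum_(s : {perm T}) 'C(#|fixpoints s|, k) ^ 2 <=
  2 ^ k * ('C(#|T|, k) * (#|T| - k)`!))%N.
Proof.
have -> : (\sum_(s : {perm T}) 'C(#|fixpoints s|, k) ^ 2 = \sum_(s : {perm T})
    ('C(#|fixpoints s|, k) *+ 'C(#|setT :&: fixpoints s|, k))%R)%N.
  by apply: eq_bigr => s _; rewrite setTI -mulr_natr natn expnS expn1.
rewrite sum_binom_fixpoints mulnC -mulnA -[#|T|]cardsT -cards_draws -sum_nat_const.
rewrite big_set /=; apply: leq_sum => K /andP[_ /eqP Kk].
have fE s : perm_on (~: K) s -> (#|fixpoints s| = k + #|~: K :&: fixpoints s|)%N.
  rewrite perm_on_fixpoints setCK => sK.
  by rewrite -(cardsID K) setIC (setIidPl sK) Kk setDE setIC.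
under eq_bigr => s Ks do rewrite (fE _ Ks) -binomial.Vandermonde.
rewrite exchange_big /= mulnC -[X in (X ^ _)%N]/(1 + 1)%N expnDn big_distrl /=.
apply: leq_sum => i _; rewrite !exp1n !muln1 -big_distrr leq_mul2l /=.
rewrite sum_binom_fixpoints_perm_on cardsCs setCK Kk cardsT.
set a := (_ - k)%N; case: (leqP (k - i) a) => h; last by rewrite (bin_small h) mul0n orbT.
rewrite -(bin_fact h) leq_mul2l; apply/orP; right; apply/orP; right.
by rewrite leq_pmull // fact_gt0.
Qed.
End Fix.

(** * Equivariant vectors in an irreducible module *)

(** The ranks of the sums of the [W i] form a submodular function: [w i] is the
   increment of the rank when [W i] is added, in a fixed order, to its
   predecessors.  Adding [W i] to fewer spaces increases the rank at least as
   much. *)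
Lemma mxrank_modular_weights (F : fieldType) (m : nat) (I : finType) (W : I -> 'M[F]_m) :
  exists w : I -> nat, (\sum_i w i = \rank (\sum_i W i)%MS)%N /\
    forall J : pred I, (\sum_(i | J i) w i <= \rank (\sum_(i | J i) W i)%MS)%N.
Proof.
suff [w [w1 w2]]: exists w : I -> nat,
    (\sum_(i <- index_enum I) w i = \rank (\sum_(i <- index_enum I) W i)%MS)%N /\
    forall J : pred I, (\sum_(i <- index_enum I | J i) w i <=
                        \rank (\sum_(i <- index_enum I | J i) W i)%MS)%N.
  by exists w.
elim: (index_enum I) (index_enum_uniq I) => [_|x s IH /= /andP[xs us]].
  by exists (fun=> 0%N); split=> [|J]; rewrite !big_nil ?mxrank0.
have [w [w1 w2]] := IH us.
pose S := (\sum_(i <- s) W i)%MS.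
have sub J : ((\sum_(i <- s | J i) W i)%MS <= S)%MS.
  rewrite /S; elim: s {IH xs us w1 w2 S} => [|y s IH]; first by rewrite !big_nil.
  rewrite !big_cons; case: ifP => _; first exact: addsmxS.
  exact: submx_trans IH (addsmxSr _ _).
exists (fun i => if i == x then (\rank (W x + S)%MS - \rank S)%N else w i).
have E J : (\sum_(i <- s | J i) (if i == x then (\rank (W x + S)%MS - \rank S) else w i)
            = \sum_(i <- s | J i) w i)%N.
  rewrite big_seq_cond [RHS]big_seq_cond; apply: eq_bigr => i /andP[si _].
  by case: eqP => // ix; move: xs; rewrite -ix si.
split=> [|J].
  rewrite [LHS]big_cons eqxx (E predT) w1 big_cons subnK //.
  by rewrite mxrankS // addsmxSr.
rewrite [leqLHS]big_cons eqxx (E J).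
rewrite [X in (_ <= \rank X)%N]big_cons; case: ifP => _; last exact: w2.
set SJ := (\sum_(i <- s | J i) W i)%MS.
have := mxrank_sum_cap (W x) S; have := mxrank_sum_cap (W x) SJ.
have : (\rank (W x :&: SJ)%MS <= \rank (W x :&: S)%MS)%N by rewrite mxrankS ?capmxS ?sub.
have := w2 J; rewrite -/SJ => h1 h2 h3 h4.
rewrite -(leq_add2r (\rank (W x :&: SJ)%MS)) h3.
rewrite (leq_trans (leq_add (leqnn _) h2)) // addnAC.
have le : (\rank S <= \rank (W x + S)%MS)%N by rewrite mxrankS ?addsmxSr.
by rewrite addnBAC // h4 addnK leq_add2l.
Qed.

(** If [P = C * B] with [C] of full column rank and [B] of full row rank, then
   [B * C] is the identity, and the two products have the same trace. *)
Lemma mxtrace_idempotent (F : fieldType) (m : nat) (P : 'M[F]_m) :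
  P *m P = P -> \tr P = (\rank P)%:R.
Proof.
move=> PP; rewrite -{1}(mulmx_base P) mxtrace_mulC.
suff -> : row_base P *m col_base P = 1%:M by rewrite mxtrace1.
apply: (row_full_inj (col_base_full P)); apply: (row_free_inj (row_base_free P)).
by rewrite /= mulmx1 mulmxA mulmx_base -mulmxA mulmx_base PP.
Qed.

Section Twist.
Import boot.fintype boot.finset.
Variables (T : finType) (th : {perm T} -> algC).
Hypothesis thM : {morph th : s t / (s * t)%g >-> s * t}.
Hypothesis th_norm : forall s, `|th s| = 1.
Local Notation G := [set: {perm T}]%G.
Variables (m : nat) (rG : mx_representation algC G m).
Implicit Types (s t g : {perm T}) (K D L : {set T}).

Definition twisted_vector (K : {set T}) p (v : 'M[algC]_(p, m)) :=
  forall s, perm_on (~: K) s -> v *m rG s = th s *: v.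

(** Projector onto the row vectors on which the pointwise stabilizer of [K] acts by
   [th]. *)
Definition twisted_proj K : 'M[algC]_m :=
  ((#|~: K|)`!)%:R^-1 *: \sum_(s | perm_on (~: K) s) th (s^-1)%g *: rG s.

Lemma twist1 : th 1%g = 1.
Proof.
have tw1_neq0 : th 1%g != 0 by rewrite -normr_eq0 th_norm oner_eq0.
by apply: (mulfI tw1_neq0); rewrite mulr1 -thM mulg1.
Qed.

Lemma twistV s : th s * th (s^-1)%g = 1.
Proof. by rewrite -thM mulgV twist1. Qed.

Lemma perm_onV A s : perm_on A s -> perm_on A (s^-1)%g.
Proof.
move=> As; apply/subsetP => x; rewrite unfold_in => sx; apply: (subsetP As).
by rewrite unfold_in; apply: contra sx => /eqP {1}<-; rewrite permK.
Qed.

Lemma twisted_proj_vector K : twisted_vector K (twisted_proj K).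
Proof.
move=> t Kt; rewrite -scalemxAl scalerA mulrC -scalerA; congr (_ *: _).
rewrite mulmx_suml scaler_sumr [RHS](reindex_inj (mulIg t)) /=.
apply: eq_big => [s|s Ks].
  apply/idP/idP => [Ks|Ks]; first exact: perm_onM.
  by rewrite -[s](mulgK t); apply: perm_onM => //; apply: perm_onV.
rewrite -scalemxAl scalerA -thM invMg mulgA mulgV mul1g.
by rewrite repr_mxM ?inE.
Qed.

Lemma twisted_vector_proj K p (v : 'M[algC]_(p, m)) :
  twisted_vector K v -> v *m twisted_proj K = v.
Proof.
move=> tv; rewrite -scalemxAr mulmx_sumr.
under eq_bigr => s Ks do rewrite -scalemxAr (tv s Ks) scalerA mulrC twistV scale1r.
rewrite sumr_const card_perm -scaler_nat scalerA mulVf ?scale1r //.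
Qed.

Lemma twisted_projP K p (v : 'M[algC]_(p, m)) :
  reflect (twisted_vector K v) (v <= twisted_proj K)%MS.
Proof.
apply: (iffP idP) => [/submxP[u ->] s Ks|/twisted_vector_proj <-]; last exact: submxMl.
by rewrite -mulmxA twisted_proj_vector // scalemxAr.
Qed.

(** The projector has its rank as trace, which is an average of values of the
   character multiplied by numbers of modulus one. *)
Lemma rank_twisted_proj_le K :
  (((#|~: K|)`! * \rank (twisted_proj K))%N%:R : algC) <=
  \sum_(s | perm_on (~: K) s) `|cfRepr rG s|.
Proof.
have E : (((#|~: K|)`! * \rank (twisted_proj K))%N%:R : algC) =
    \sum_(s | perm_on (~: K) s) th (s^-1)%g * \tr (rG s).
  rewrite natrM -mxtrace_idempotent; last exact/twisted_vector_proj/twisted_proj_vector.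
  rewrite mxtraceZ mulrA mulfV ?mul1r; last by rewrite pnatr_eq0 -lt0n fact_gt0.
  by rewrite raddf_sum /=; apply: eq_bigr => s _; rewrite mxtraceZ.
rewrite -[leLHS]normr_nat E; apply: le_trans (ler_norm_sum _ _ _) _.
by apply: ler_sum => s _; rewrite normrM th_norm mul1r cfunE in_setT mulr1n.
Qed.

Lemma twisted_projS K L : K \subset L -> (twisted_proj K <= twisted_proj L)%MS.
Proof.
move=> sKL; apply/twisted_projP => s Ls; apply: twisted_proj_vector.
by apply: subset_trans Ls _; rewrite setCS.
Qed.

Lemma twisted_projJ D g :
  (twisted_proj D *m rG g <= twisted_proj (g @: D))%MS.
Proof.
apply/twisted_projP => t gt.
rewrite -mulmxA -repr_mxM ?inE // -[(g * t)%g](mulgKV g) repr_mxM ?inE // mulmxA.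
have Dgt : perm_on (~: D) (g * t * g^-1)%g.
  apply/subsetP => x; rewrite unfold_in inE; apply: contra => Dx.
  rewrite !permM; apply/eqP; rewrite -[RHS](permK g); congr (_ _).
  apply/eqP; apply: contraTT (imset_f g Dx) => h.
  by have := subsetP gt (g x); rewrite unfold_in h inE => /(_ isT).
by rewrite (twisted_proj_vector Dgt) !thM mulrAC twistV mul1r scalemxAl.
Qed.

Hypothesis irrG : mx_irreducible rG.
Variables (O : {set T}) (v : 'rV[algC]_m).
Hypothesis v_neq0 : v != 0.
Hypothesis v_twisted : twisted_vector O v.

(** The sum is stable under the group, since [g] sends the space attached to [D]
   into the one attached to its image, and it contains [v]. *)
Lemma sum_twisted_proj_full :
  (\sum_(D : {set T} | #|D| == #|O|) twisted_proj D :=: 1%:M)%MS.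
Proof.
set S := (\sum_(D | _) _)%MS; apply/eqmxP; rewrite submx1 /=.
case: irrG => _ _; apply; rewrite ?submx1 //; last first.
  apply: contraNneq v_neq0 => S0; rewrite -submx0 -S0.
  apply: submx_trans (sumsmx_sup O _ (submx_refl _)) => //.
  exact/twisted_projP.
apply/mxmoduleP => g _; rewrite sumsmxMr; apply/sumsmx_subP => D /eqP DO.
apply: submx_trans (twisted_projJ D g) _.
by apply: (sumsmx_sup (g @: D)) => //; rewrite card_imset ?DO //; apply: perm_inj.
Qed.

(** Among the spaces attached to the sets [D] of size [#|O|], those with [D]
   inside a [k]-set [K] lie in the space attached to [K], so its rank is at
   least the sum of their modular weights.  Each [D] lies in
   ['C(#|T| - #|O|, k - #|O|)] such [K], and all the weights add up to [m]. *)
Lemma sum_binom_fixpoints_char_ge k : (#|O| <= k <= #|T|)%N ->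
  (((#|T| - k)`! * ('C(#|T| - #|O|, k - #|O|) * m))%N%:R : algC) <=
  \sum_s `|cfRepr rG s| *+ 'C(#|fixpoints s|, k).
Proof.
case/andP => Ok kT.
have [w [w1 w2]] := mxrank_modular_weights
  (fun D : {set T} => if #|D| == #|O| then twisted_proj D else 0).
have w0 D : #|D| != #|O| -> w D = 0%N.
  move=> /negPf DO; have := w2 (pred1 D); rewrite !big_pred1_eq DO mxrank0.
  by rewrite leqn0 => /eqP.
have wm : (\sum_(D : {set T} | #|D| == #|O|) w D = m)%N.
  rewrite big_mkcond /=.
  have <- : (\sum_D w D = m)%N.
    by rewrite w1 -big_mkcond /= sum_twisted_proj_full mxrank1.
  by apply: eq_bigr => D _; case: ifPn => // /w0.
under eq_bigr => s _ do rewrite -[fixpoints s]setTI.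
rewrite sum_binom_fixpoints.
have card_sup D : #|D| == #|O| ->
    #|[set K : {set T} | (D \subset K) && (#|K| == k)]| = 'C(#|T| - #|O|, k - #|O|).
  move=> /eqP DO; rewrite -(bin_sub (leq_sub2r #|O| kT)).
  have -> : (#|T| - #|O| - (k - #|O|) = #|T| - k)%N by rewrite subnBA // subnK // (leq_trans Ok).
  have <- : #|~: D| = (#|T| - #|O|)%N by rewrite [LHS]cardsCs setCK DO.
  rewrite -cards_draws -(card_imset _ (can_inj (@setCK T))).
  apply: eq_card => K; rewrite inE; apply/imsetP/andP => [[L + ->]|[KD /eqP Kk]].
    by rewrite inE => /andP[DL /eqP Lk]; rewrite setCS DL [X in X == _]cardsCs setCK Lk.
  exists (~: K); last by rewrite setCK.
  rewrite inE subsetC KD [X in X == _]cardsCs setCK Kk.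
  by rewrite subKn ?eqxx.
have rank_ge K : #|K| = k -> (\sum_(D : {set T} | (#|D| == #|O|) && (D \subset K)) w D
    <= \rank (twisted_proj K))%N.
  move=> Kk; apply: leq_trans (w2 _) (mxrankS _).
  by apply/sumsmx_subP => D /andP[-> DK]; apply: twisted_projS.
apply: (@le_trans _ _ (\sum_(K : {set T} | #|K| == k)
    ((#|T| - k)`! * \rank (twisted_proj K))%N%:R)).
  rewrite -natr_sum ler_nat -big_distrr leq_mul2l; apply/orP; right.
  apply: (@leq_trans (\sum_(K : {set T} | #|K| == k)
      \sum_(D : {set T} | (#|D| == #|O|) && (D \subset K)) w D)%N); last first.
    by apply: leq_sum => K /eqP; apply: rank_ge.
  under eq_bigr do rewrite big_mkcondr /=.
  rewrite exchange_big /= -wm big_distrr /=; apply: leq_sum => D DO.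
  rewrite -(card_sup D DO) -big_mkcondr sum_nat_const; apply: eq_leq.
  by congr (_ * _)%N; apply: eq_card => K; rewrite !inE andbC.
under [leRHS]eq_bigl do rewrite subsetT andTb.
apply: ler_sum => K /eqP Kk.
have <- : #|~: K| = (#|T| - k)%N by rewrite [LHS]cardsCs setCK Kk.
exact: rank_twisted_proj_le.
Qed.
End Twist.

(** * Translates of a Young symmetrizer *)

Section Cells.
Import boot.fintype boot.finset.

(** Induction on the number of points of [O] outside [D], by one transposition at
   a time. *)
Lemma perm_on_imset_transitive (T : finType) (A O D : {set T}) :
  O \subset A -> D \subset A -> #|O| = #|D| ->
  exists2 g : {perm T}, perm_on A g & g @: O = D.
Proof.
elim: {O}#|O :\: D| {-2}O (leqnn #|O :\: D|) => [|k IH] O OD OA DA cOD.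
  exists 1%g; first exact: perm_on1.
  have -> : O = D.
    apply/eqP; rewrite eqEcard cOD leqnn andbT -setD_eq0.
    by rewrite -cards_eq0 -leqn0.
  by rewrite (eq_imset (g := id)) ?imset_id // => x; rewrite perm1.
have [OD0|[x]] := set_0Vmem (O :\: D).
  by apply: IH => //; rewrite OD0 cards0.
rewrite !inE => /andP[xD xO].
have [y]: exists y, y \in D :\: O.
  apply/set0Pn; rewrite -cards_eq0 -(eqn_add2l #|D :&: O|) cardsID addn0 -cOD.
  rewrite -(cardsID D O) setIC -{2}[#|_ :&: _|]addn0 eqn_add2l cards_eq0.
  by apply/set0Pn; exists x; rewrite inE xD.
rewrite !inE => /andP[yO yD].
have xy : x != y by apply: contraNneq xD => ->.
have tO : tperm x y @: O = y |: (O :\ x).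
  apply/setP => z; rewrite -{1}[z](tpermK x y) mem_imset; last exact: perm_inj.
  rewrite !inE; case: tpermP => [->|->|/eqP zx /eqP zy].
  - by rewrite (negPf yO) (negPf xy) eqxx.
  - by rewrite xO eqxx.
  - by rewrite (negPf zx) (negPf zy).
have [||||g gA gO] := IH (tperm x y @: O).
- rewrite tO -ltnS; apply: leq_trans OD; rewrite [X in (_ < X)%N](cardsD1 x) inE xD xO /=.
  rewrite add1n ltnS subset_leq_card //; apply/subsetP => z; rewrite !inE.
  by case/andP=> zD /orP[/eqP zy|/andP[-> ->]]; [rewrite zy yD in zD | rewrite zD].
- rewrite tO; apply/subsetP => z; rewrite !inE => /orP[/eqP->|/andP[_]].
    exact: (subsetP DA).
  exact: (subsetP OA).
- by [].
- by rewrite card_imset //; apply: perm_inj.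
exists (tperm x y * g)%g.
  apply: perm_onM => //; apply/subsetP => z; rewrite unfold_in.
  case: tpermP => [-> _|-> _|_ _]; rewrite ?eqxx //.
    exact: (subsetP OA).
  exact: (subsetP DA).
rewrite -gO -imset_comp; by apply: eq_imset => z; rewrite permM.
Qed.

Variable T : finType.
Implicit Types (p : T -> nat) (s t g : {perm T}).

Definition stab p : {set {perm T}} := [set s : {perm T} | [forall i, p (s i) == p i]].

Lemma stabP p s : reflect (forall i, p (s i) = p i) (s \in stab p).
Proof. by rewrite inE; apply: (iffP forallP) => h i; apply/eqP. Qed.

Lemma stab_group_set p : group_set (stab p).
Proof.
apply/group_setP; split=> [|s t /stabP hs /stabP ht]; first by apply/stabP => i; rewrite perm1.
by apply/stabP => i; rewrite permM ht.
Qed.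
Canonical stab_group p := Group (stab_group_set p).

(** The cells outside the first row, or outside the first column, according to [p]. *)
Definition outside p : {set T} := [set i | p i != 0%N].

(** With [p] and [p'] the row and the column of a cell: the cells of the first row
   whose column has another cell.  With the roles exchanged, the same for the
   first column. *)
Definition linked p p' : {set T} :=
  [set i | (p i == 0%N) && [exists o in outside p, p' o == p' i]].

Lemma perm_on_stab p s : perm_on (~: outside p) s -> s \in stab p.
Proof.
move=> ps; apply/stabP => i; case: (boolP (i \in ~: outside p)) => Oi; last first.
  by rewrite (out_perm ps Oi).
have := Oi; rewrite -(perm_closed _ ps).
by rewrite !inE !negbK in Oi * => /eqP ->; apply/esym/eqP.
Qed.

Variables (p p' : T -> nat).
Hypothesis pp_inj : forall i j, p i = p j -> p' i = p' j -> i = j.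

Lemma stabI s : s \in stab p -> s \in stab p' -> s = 1%g.
Proof.
by move=> /stabP h /stabP h'; apply/permP => i; rewrite perm1; apply: pp_inj.
Qed.

(** A point where [p] vanishes is determined by its value under [p'], so distinct
   linked points have distinct partners in [outside p]. *)
Lemma card_linked : (#|linked p p'| <= #|outside p|)%N.
Proof.
pose f i := odflt i [pick o in outside p | p' o == p' i].
have fP i : i \in linked p p' -> (f i \in outside p) /\ (p' (f i) = p' i).
  rewrite inE => /andP[_ /existsP[y /andP[yO yi]]]; rewrite /f.
  by case: pickP => [z /andP[zO /eqP zi] | /(_ y)]; rewrite ?yO ?yi.
rewrite -(card_in_imset (f := f)); last first.
  move=> i j iQ jQ fij; apply: pp_inj; last by rewrite -(fP i iQ).2 fij (fP j jQ).2.
  by move: iQ jQ; rewrite !inE => /andP[/eqP-> _] /andP[/eqP-> _].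
by apply: subset_leq_card; apply/subsetP => _ /imsetP[i /fP[fi _] ->].
Qed.

(** [s] preserves [outside p], and [t] can only move a point of it out of it by
   entering [linked p p'], which [g] preserves and [g' @: outside p] avoids. *)
Lemma outside_translates_eq s t g g' :
  s \in stab p -> t \in stab p' -> g' = (s * t * g)%g ->
  perm_on (~: linked p p') g -> g' @: outside p \subset ~: linked p p' ->
  g' @: outside p = g @: outside p.
Proof.
move=> /stabP sp /stabP tp -> gQ /subsetP g'Q.
apply/eqP; rewrite eqEcard !card_imset ?leqnn ?andbT; try exact: perm_inj.
apply/subsetP => x xim; have xQ := g'Q _ xim; case/imsetP: xim xQ => o oO -> {x}.
rewrite !permM; set i := s o => giQ; apply: imset_f.
have iO : i \in outside p by rewrite inE sp; rewrite inE in oO.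
have {giQ} tiQ : t i \in ~: linked p p' by rewrite -(perm_closed _ gQ).
rewrite inE; apply: contraTN tiQ => ti0; rewrite !inE negbK ti0 /=.
by apply/existsP; exists i; rewrite iO tp eqxx.
Qed.

End Cells.

Section Symmetrizer.
Import boot.fintype boot.finset.
Variables (T : finType) (p p' : T -> nat).
Hypothesis pp_inj : forall i j, p i = p j -> p' i = p' j -> i = j.
Local Notation G := [set: {perm T}]%G.
Local Notation aG := (regular_repr algC G).
Implicit Types (s t g h x : {perm T}).

Definition symmetrizer : 'rV[algC]_#|G| :=
  gring_row ((\sum_(s in stab p) aG s) *m (\sum_(s in stab p') (-1) ^+ s *: aG s)).

Definition symmetrizer_coef x : algC :=
  \sum_(s in stab p) \sum_(t in stab p') (-1) ^+ t *+ (x == s * t)%g.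

Lemma symmetrizer_coefE g h :
  (symmetrizer *m aG g) 0 (gring_index G h) = symmetrizer_coef (h * g^-1)%g.
Proof.
rewrite -gring_row_mul mulmx_suml !(mulmx_suml, linear_sum, summxE).
apply: eq_bigr => s _; rewrite mulmx_sumr !(mulmx_suml, linear_sum, summxE).
apply: eq_bigr => t _; rewrite -scalemxAr -scalemxAl -!repr_mxM ?inE // linearZ /=.
rewrite mxE -mulr_natr; congr (_ * _).
rewrite /gring_row rowK gring_indexK ?inE // mul1g mxE eqxx /=.
congr (_%:R); congr nat_of_bool.
rewrite -(inj_eq (can_inj (@gring_valK _ G))) !gring_indexK ?inE //.
by rewrite -[in RHS](inj_eq (mulIg g)) mulgKV.
Qed.

Lemma symmetrizer_coef_neq0 x : symmetrizer_coef x != 0 ->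
  exists s t, [/\ s \in stab p, t \in stab p' & x = (s * t)%g].
Proof.
case: (boolP [exists s in stab p, [exists t in stab p', x == (s * t)%g]]).
  by case/existsP=> s /andP[sp /existsP[t /andP[tp /eqP xE]]]; exists s, t.
move=> h; rewrite /symmetrizer_coef big1 ?eqxx // => s sp; rewrite big1 // => t tp.
case: eqP => // xE; case/negP: h; apply/existsP; exists s; rewrite sp.
by apply/existsP; exists t; rewrite tp xE eqxx.
Qed.

(** The two stabilizers meet trivially, so [x = x * 1] is the only factorization. *)
Lemma symmetrizer_coef_stab x : x \in stab p -> symmetrizer_coef x = 1.
Proof.
move=> xp; rewrite /symmetrizer_coef (bigD1 x) //= (bigD1 1%g) ?group1 //= mulg1 eqxx odd_perm1.
rewrite big1 ?addr0 => [|t /andP[tp t1]]; last first.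
  case: eqP => // /esym/eqP; rewrite -{2}[x]mulg1 (inj_eq (mulgI x)) => /eqP t1'.
  by rewrite t1' eqxx in t1.
rewrite big1 ?addr0 // => s /andP[sp sx]; rewrite big1 // => t tp.
case: eqP => // xE; case/eqP: sx.
have t1 : t = 1%g.
  apply: (stabI pp_inj) => //.
  by rewrite -[t](mulKg s) -xE groupM ?groupV.
by rewrite xE t1 mulg1.
Qed.

Lemma symmetrizer_neq0 : symmetrizer != 0.
Proof.
apply/eqP => e0; have := symmetrizer_coefE 1%g 1%g.
rewrite e0 mul0mx mxE invg1 mulg1 symmetrizer_coef_stab ?group1 //.
by move/eqP; rewrite eq_sym oner_eq0.
Qed.

Lemma symmetrizer_sign t : t \in stab p' -> symmetrizer *m aG t = (-1) ^+ t *: symmetrizer.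
Proof.
move=> tp; rewrite -gring_row_mul -linearZ /=; congr gring_row.
rewrite -mulmxA scalemxAr; congr (_ *m _).
rewrite mulmx_suml scaler_sumr [RHS](reindex_inj (mulIg t)) /=.
apply: eq_big => [s|s sp]; first by rewrite groupMr.
by rewrite -scalemxAl scalerA odd_permM signr_addb mulrCA -signr_addb addbb mulr1 repr_mxM ?inE.
Qed.

(** Its coordinate at the identity is the order of the row stabilizer: only
   factorizations with a trivial (hence even) column factor contribute. *)
Lemma symmetrizer_row_sum_neq0 : symmetrizer *m (\sum_(s in stab p) aG s) != 0.
Proof.
apply/eqP => /(congr1 (fun u : 'rV_#|G| => u 0 (gring_index G 1%g))) /eqP.
rewrite mulmx_sumr summxE mxE.
under eq_bigr => s sp do rewrite symmetrizer_coefE mul1g symmetrizer_coef_stab ?groupV //.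
by rewrite sumr_const pnatr_eq0 eqn0Ngt (cardG_gt0 (stab_group p)).
Qed.

Lemma row_sum_fixed t : t \in stab p ->
  (\sum_(s in stab p) aG s) *m aG t = \sum_(s in stab p) aG s.
Proof.
move=> tp; rewrite mulmx_suml [RHS](reindex_inj (mulIg t)) /=.
apply: eq_big => [s|s sp]; first by rewrite groupMr.
by rewrite repr_mxM ?inE.
Qed.

(** For every [D] outside [Q] with [#|D| = #|O|], choose a permutation [g_D] that
   fixes [Q] pointwise and sends [O] to [D].  By hypothesis the coordinate of the
   translate by [g_D] at [g_D'] vanishes unless [D = D'], so these translates
   are linearly independent. *)
Lemma rank_cyclic_symmetrizer (Q O : {set T}) : O \subset ~: Q ->
  (forall g g', symmetrizer_coef (g' * g^-1)%g != 0 ->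
     perm_on (~: Q) g -> perm_on (~: Q) g' -> g @: O = g' @: O) ->
  ('C(#|T| - #|Q|, #|O|) <= \rank (cyclic_mx aG symmetrizer))%N.
Proof.
move=> OQ sep; pose DD := [set D : {set T} | D \subset ~: Q & #|D| == #|O|].
have cQ : (#|T| - #|Q|)%N = #|~: Q| by rewrite [RHS]cardsCs setCK.
rewrite cQ -cards_draws -/DD.
have gP D : exists g : {perm T}, D \in DD -> perm_on (~: Q) g /\ g @: O = D.
  case: (boolP (D \in DD)) => [|_]; last by exists 1%g.
  rewrite inE => /andP[DQ /eqP DO].
  by have [g] := perm_on_imset_transitive OQ DQ (esym DO); exists g.
pose g D : {perm T} := sval (cid (gP D)).
have gE D : D \in DD -> perm_on (~: Q) (g D) /\ g D @: O = D := svalP (cid (gP D)).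
pose X : 'M[algC]_(#|DD|, #|G|) :=
  \matrix_(i < #|DD|) (symmetrizer *m aG (g (enum_val i))).
pose Y : 'M[algC]_(#|G|, #|DD|) :=
  \matrix_(x, j) (x == gring_index G (g (enum_val j)))%:R.
have XY : X *m Y = 1%:M.
  apply/matrixP => i j; rewrite [LHS]mxE [RHS]mxE (bigD1 (gring_index G (g (enum_val j)))) //=.
  rewrite [X in _ + X]big1 ?addr0 => [|x /negPf xj]; last by rewrite [Y _ _]mxE xj mulr0.
  rewrite [Y _ _]mxE eqxx mulr1 [X _ _]mxE symmetrizer_coefE.
  have [gi gO] := gE _ (enum_valP i); have [gj gO'] := gE _ (enum_valP j).
  case: eqP => [->|ij]; first by rewrite mulgV symmetrizer_coef_stab ?group1.
  apply/eqP; apply: contra_notT ij => /sep /(_ gi gj); rewrite gO gO'.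
  exact: enum_val_inj.
have /eqP <- : row_free X by apply/row_freeP; exists Y.
apply: mxrankS; apply/row_subP => i; rewrite rowK.
apply/cyclic_mxP; exists (aG (g (enum_val i))) => //.
by apply: envelop_mx_id; rewrite inE.
Qed.

End Symmetrizer.

(** * Specht modules of a given level *)

Section Partition.
Import boot.fintype boot.finset.
Local Open Scope nat_scope.
Variables (n : nat) (l : seq nat).
Hypothesis ln : is_partition_of n l.

Let ln_sum : sumn l = n. Proof. by case/and3P: ln => _ _ /eqP. Qed.
Let l_gt0 k : k \in l -> 0 < k. Proof. by case/and3P: ln => _ /allP h _; apply: h. Qed.

Lemma cell_inj (i j : 'I_n) : reshape_index l i = reshape_index l j ->
  reshape_offset l i = reshape_offset l j -> i = j.
Proof.
move=> ij1 ij2; apply: val_inj.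
by rewrite /= -(reshape_indexK l i) ij1 ij2 reshape_indexK.
Qed.

Lemma card_outside_image (p : 'I_n -> nat) m (f : 'I_m -> nat) :
  injective f -> (forall j, f j < n) ->
  (forall i : 'I_n, p i = 0 <-> exists j, f j = i :> nat) ->
  #|outside p| = n - m.
Proof.
move=> f_inj fn fP; rewrite cardsCs card_ord.
have f'_inj : injective (fun j => Ordinal (fn j)) by move=> i j [/f_inj].
congr (n - _); rewrite -[RHS]card_ord -(card_imset predT f'_inj).
apply: eq_card => i; rewrite !inE negbK; apply/eqP/imsetP => [/fP[j fj]|[j _ ->]].
  by exists j => //; apply: val_inj.
by apply/fP; exists j.
Qed.

Lemma card_outside_row : #|outside (fun i : 'I_n => reshape_index l i)| = n - head 0 l.
Proof.
case: l ln_sum => [|h t] /= lE.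
  by rewrite -lE; apply/eqP; rewrite -leqn0 (leq_trans (max_card _)) // card_ord.
apply: (@card_outside_image _ h (fun j => j)) => [||i].
- exact: val_inj.
- by move=> j; rewrite -lE (leq_trans (ltn_ord j)) // leq_addr.
rewrite /reshape_index /= subn_eq0; case: (ltnP i h) => ih.
  by split=> // _; exists (Ordinal ih).
by split=> // -[j ji]; move: ih; rewrite -ji leqNgt ltn_ord.
Qed.

Lemma nth_part_gt0 r : r < size l -> 0 < nth 0 l r.
Proof. by move=> rl; apply: l_gt0; apply: mem_nth. Qed.

Lemma card_outside_col :
  #|outside (fun i : 'I_n => reshape_offset l i)| = n - head 0 (conj_partition l).
Proof.
have -> : head 0 (conj_partition l) = size l.
  rewrite /conj_partition; case: l l_gt0 => [//|h t] gt0 /=.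
  case: h gt0 => [/(_ 0)|h gt0]; first by rewrite inE eqxx => /(_ isT).
  rewrite /= add1n; congr _.+1; apply/eqP; rewrite -all_count; apply/allP => k kt.
  by apply: gt0; rewrite inE kt orbT.
apply: (@card_outside_image _ (size l) (fun j => flatten_index l j 0)) => [j k jk||i].
- apply: val_inj; rewrite /= -(@flatten_indexKl l j 0) ?nth_part_gt0 // jk.
  by rewrite flatten_indexKl ?nth_part_gt0.
- by move=> j; rewrite -ln_sum flatten_indexP // nth_part_gt0.
split=> [i0|[j <-]]; last by rewrite flatten_indexKr // nth_part_gt0.
have il : reshape_index l i < size l by apply: reshape_indexP; rewrite ln_sum.
by exists (Ordinal il); rewrite /= -i0 reshape_indexK.
Qed.

End Partition.

Section Irreducible.
Import boot.fintype boot.finset.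
Variables (n : nat).
Local Notation G := [set: 'S_n]%G.
Local Notation aG := (regular_repr algC G).

(** The interface between representation theory and analysis: a degree bound and
   the correlation of [|chi|] with the number of fixed [k]-sets. *)
Definition char_spread (chi : 'CF(G)) (d : nat) :=
  exists m : nat, [/\ chi 1%g = m%:R, ('C(n - d, d) <= m)%N &
    forall k, (d <= k <= n)%N ->
      (((n - k)`! * ('C(n - d, k - d) * m))%N%:R : algC) <=
      \sum_s `|chi s| *+ 'C(#|fixpoints s|, k)].

(** An equivariant vector of the simple submodule [U] yields one of the
   representation that [U] affords. *)
Lemma char_spread_submod (chi : 'CF(G)) (U : 'M[algC]_#|G|) (modU : mxmodule aG U)
    (O : {set 'I_n}) (th : 'S_n -> algC) (v : 'rV[algC]_#|G|) :
  chi \in irr G -> chi = cfRepr (submod_repr modU) ->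
  {morph th : s t / (s * t)%g >-> s * t} -> (forall s, `|th s| = 1) ->
  ('C(n - #|O|, #|O|) <= \rank U)%N ->
  v != 0 -> (v <= U)%MS ->
  (forall s, perm_on (~: O) s -> v *m aG s = th s *: v) ->
  char_spread chi #|O|.
Proof.
move=> chi_irr chiE thM th_norm rankU v0 vU vth.
exists (\rank U); split=> //; first by rewrite chiE cfRepr1.
have irrU : mx_irreducible (submod_repr modU).
  have /irr_reprP[rG irrG chiE'] := chi_irr.
  have sim : mx_rsim rG (submod_repr modU) by apply: cfRepr_inj; rewrite -chiE' chiE.
  exact: mx_rsim_irr sim irrG.
have u0 : in_submod U v != 0.
  by apply: contraNneq v0 => u0; rewrite -(in_submodK vU) u0 linear0.
have uth : twisted_vector th (submod_repr modU) O (in_submod U v).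
  by move=> s sO; rewrite -in_submodJ // vth // linearZ.
move=> k; rewrite -[in (k <= n)%N](card_ord n) => kn.
have := sum_binom_fixpoints_char_ge thM th_norm irrU u0 uth kn.
by rewrite -chiE card_ord.
Qed.

(** If the level is read on the first row, the symmetrizer multiplied by the sum of
   the row stabilizer is invariant under it; if it is read on the first
   column, the symmetrizer itself is a sign vector for the column stabilizer.
   In both cases a nonzero coefficient of the symmetrizer at [g' * g^-1]
   relates [g] and [g'] as in [outside_translates_eq], after taking inverses
   in the second case. *)
Lemma char_spread_level (chi : 'CF(G)) d :
  chi \in irr G -> has_level chi d -> char_spread chi d.
Proof.
move=> chi_irr [l [ln chiE dE]].
pose row (i : 'I_n) := reshape_index l i; pose col (i : 'I_n) := reshape_offset l i.
have rc := cell_inj; have cr i j (h1 : col i = col j) h2 := @rc n l i j h2 h1.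
have eE : young_symmetrizer n l = symmetrizer row col by [].
have bnd (p p' : 'I_n -> nat) : (forall i j, p i = p j -> p' i = p' j -> i = j) ->
    ('C(n - #|outside p|, #|outside p|) <= 'C(#|'I_n| - #|linked p p'|, #|outside p|))%N.
  move=> pp; have h := card_linked pp.
  by rewrite leq_bin2l // card_ord leq_sub2l.
have OQ (p p' : 'I_n -> nat) : outside p \subset ~: linked p p'.
  by apply/subsetP => i; rewrite !inE => /negPf ->.
rewrite {}dE /partition_level; case: (leqP (n - head 0 l)%N (n - head 0 (conj_partition l))%N) => _.
- rewrite -card_outside_row //.
  apply: (char_spread_submod (th := fun=> 1) (v := symmetrizer row col *m \sum_(s in stab row) aG s)
    chi_irr chiE).
  + by move=> s t; rewrite mulr1.
  + by move=> s; rewrite normr1.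
  + apply: leq_trans (bnd row col (@rc n l)) _; rewrite eE.
    apply: (rank_cyclic_symmetrizer (@rc n l) (OQ row col)) => g g' /symmetrizer_coef_neq0.
    case=> s [t [sr tc gE]] gQ g'Q; apply/esym.
    apply: (outside_translates_eq sr tc _ gQ); first by rewrite -gE mulgKV.
    apply/subsetP => _ /imsetP[y yO ->]; rewrite perm_closed //.
    exact: (subsetP (OQ row col)).
  + exact: symmetrizer_row_sum_neq0 (@rc n l).
  + rewrite mulmx_sumr; apply: summx_sub => s _; rewrite eE.
    by apply: mxmodule_trans (cyclic_mx_id _ _); rewrite ?cyclic_mx_module ?inE.
  + move=> s sO; rewrite scale1r -mulmxA row_sum_fixed //.
    exact: perm_on_stab.
rewrite -card_outside_col //.
apply: (char_spread_submod (th := fun s : 'S_n => (-1) ^+ s) (v := symmetrizer row col) chi_irr chiE).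
- by move=> s t; rewrite odd_permM signr_addb.
- by move=> s; rewrite normr_sign.
- apply: leq_trans (bnd col row cr) _; rewrite eE.
  apply: (rank_cyclic_symmetrizer (@rc n l) (OQ col row)) => g g' /symmetrizer_coef_neq0.
  case=> s [t [sr tc gE]] gQ g'Q.
  apply: (outside_translates_eq (s := t^-1%g) (t := s^-1%g)) (groupVr tc) (groupVr sr) _ g'Q _.
    by rewrite -invMg -gE invMg invgK mulgKV.
  apply/subsetP => _ /imsetP[y yO ->]; rewrite perm_closed //.
  exact: (subsetP (OQ col row)).
- exact: symmetrizer_neq0 (@rc n l).
- by rewrite eE cyclic_mx_id.
by move=> s sO; apply: symmetrizer_sign; apply: perm_on_stab.
Qed.
End Irreducible.

(** * Real algebraic numbers and a three-term Hoelder inequality *)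

Section RealOfAlgC.
Variable R : realType.
Local Notation rho := (real_of_algC R).
Local Open Scope classical_set_scope.

Let cut (x : algC) : set R := [set (ratr r : R) | r in [set r : rat | (ratr r : algC) <= x]].

Lemma cut_ubound (x : algC) (a : rat) : x <= ratr a -> ubound (cut x) (ratr a).
Proof. by move=> xa _ [r /= rx <-]; rewrite ler_rat -(ler_rat algC) (le_trans rx). Qed.

Lemma real_algC_itv (x : algC) : x \is Num.real ->
  exists a b : rat, (ratr a : algC) <= x /\ x <= ratr b.
Proof.
move=> xr; have [N xN] : exists N : nat, `|x| <= N%:R.
  by exists (Num.Def.archi_bound `|x|); rewrite ltW // archi_boundP.
exists (- N%:R), N%:R; rewrite rmorphN /= !rmorph_nat.
by apply/andP; rewrite -real_ler_norml.
Qed.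

Lemma real_of_algC_le_ratr x a : x \is Num.real -> x <= ratr a -> rho x <= ratr a.
Proof.
move=> xr xa; apply: ge_sup; last exact: cut_ubound.
by have [b [_ [bx _]]] := real_algC_itv xr; exists (ratr b), b.
Qed.

Lemma ratr_le_real_of_algC x a : x \is Num.real -> ratr a <= x -> ratr a <= rho x.
Proof.
move=> xr xa; apply: ub_le_sup; last by exists a.
by have [_ [b [_ xb]]] := real_algC_itv xr; exists (ratr b); apply: cut_ubound.
Qed.

Lemma real_of_algC_nat m : rho m%:R = m%:R.
Proof.
have := @real_of_algC_le_ratr m%:R m%:R (realn _ m).
have := @ratr_le_real_of_algC m%:R m%:R (realn _ m).
rewrite !rmorph_nat lexx => /(_ isT) h1 /(_ isT) h2.
by apply/le_anti; rewrite h1 h2.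
Qed.

Lemma real_of_algC_ge0 x : 0 <= x -> 0 <= rho x.
Proof.
move=> x0; have := @ratr_le_real_of_algC x 0 (ger0_real x0).
by rewrite !rmorph0; apply.
Qed.

Lemma real_of_algC_le x y : x \is Num.real -> y \is Num.real -> x <= y -> rho x <= rho y.
Proof.
move=> xr yr xy; apply: ge_sup.
  by have [b [_ [bx _]]] := real_algC_itv xr; exists (ratr b), b.
by move=> _ [r /= rx <-]; apply: ratr_le_real_of_algC => //; apply: le_trans rx xy.
Qed.

(** Any rationals above [rho x] and [rho y] bound [x] and [y], so their sum bounds
   [x + y]. *)
Lemma real_of_algCD_le x y : x \is Num.real -> y \is Num.real ->
  rho (x + y) <= rho x + rho y.
Proof.
have above z (e : R) : z \is Num.real -> 0 < e ->
    exists2 a : rat, z <= ratr a & ratr a <= rho z + e.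
  move=> zr e0; have /rat_in_itvoo[a] : rho z < rho z + e by rewrite ltrDl.
  rewrite in_itv /= => /andP[za ae]; exists a; last exact: ltW.
  rewrite real_leNgt //; last by rewrite realE ler0q lerq0 le_total.
  by apply: contraTN za => /ltW /(ratr_le_real_of_algC zr) h; rewrite -leNgt.
move=> xr yr; apply/ler_addgt0Pr => e e0.
have e20 : 0 < e / 2 by rewrite divr_gt0.
have [a xa ae] := above _ _ xr e20; have [b yb be] := above _ _ yr e20.
apply: (@le_trans _ _ (ratr (a + b))).
  by apply: real_of_algC_le_ratr; rewrite ?realD // rmorphD lerD.
rewrite rmorphD /=; lra.
Qed.

Lemma real_of_algC_sum_le (I : finType) (x : I -> algC) : (forall i, x i \is Num.real) ->
  rho (\sum_i x i) <= \sum_i rho (x i).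
Proof.
move=> xr; suff [] : \sum_i x i \is Num.real /\ rho (\sum_i x i) <= \sum_i rho (x i) by [].
elim/big_rec2: _ => [|i a b _ [br ba]]; first by rewrite (real_of_algC_nat 0) real0.
by rewrite realD // (le_trans (real_of_algCD_le _ _)) // lerD2l.
Qed.

Lemma real_of_algCMn_le x m : x \is Num.real -> rho (x *+ m) <= rho x *+ m.
Proof.
move=> xr; rewrite -[m]card_ord -!sumr_const.
exact: real_of_algC_sum_le.
Qed.

End RealOfAlgC.

Section Hoelder.
Variable R : realType.

(** Convexity of the exponential, from its tangent at the weighted mean [g] of the
   logarithms. *)
Lemma weighted_amgm3 (u v a b c : R) : 0 <= u -> 0 <= v -> u + v + u = 1 ->
  0 < a -> 0 < b -> 0 < c ->
  a `^ u * b `^ v * c `^ u <= u * a + v * b + u * c.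
Proof.
move=> u0 v0 uv a0 b0 c0.
rewrite /powR !gt_eqF // -!expRD.
set g := _ + _; have E x : 0 < x -> expR g * (1 + (ln x - g)) <= x.
  move=> x0; have {2}-> : x = expR g * expR (ln x - g) by rewrite -expRD addrC subrK lnK.
  by rewrite ler_pM2l ?expR_gt0 // expR_ge1Dx.
have Ea := E _ a0; have Eb := E _ b0; have Ec := E _ c0.
have -> : expR g = u * (expR g * (1 + (ln a - g))) + v * (expR g * (1 + (ln b - g)))
   + u * (expR g * (1 + (ln c - g))).
  transitivity (expR g * ((u + v + u) * (1 - g) + g)); first by rewrite uv mul1r subrK mulr1.
  rewrite /g; ring.
by rewrite !lerD // ler_wpM2l.
Qed.

(** Normalize the three sums to 1 and apply the weighted inequality of means to
   every term, with [X = X `^ (1 - 2 / q) * (X ^+ 2) `^ q^-1]. *)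
Lemma hoelder_sum_square (I : finType) (q : R) (x X : I -> R) : 2 <= q ->
  (forall i, 0 <= x i) -> (forall i, 0 <= X i) ->
  \sum_i x i * X i <= (\sum_i x i `^ q) `^ q^-1 * (\sum_i X i) `^ (1 - 2 / q) *
                      (\sum_i X i ^+ 2) `^ q^-1.
Proof.
move=> q2 x0 X0; have q0 : 0 < q by lra.
have qn0 : q != 0 by rewrite gt_eqF.
set U := \sum_i x i `^ q; set V := \sum_i X i; set W := \sum_i X i ^+ 2.
have rhs0 : 0 <= U `^ q^-1 * V `^ (1 - 2 / q) * W `^ q^-1 by rewrite !mulr_ge0 ?powR_ge0.
have W0 i : 0 < X i -> 0 < W.
  move=> Xi; apply: lt_le_trans (exprn_gt0 2 Xi) _.
  by rewrite /W (bigD1 i) //= lerDl sumr_ge0 // => j _; rewrite exprn_ge0.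
have V0 i : 0 < X i -> 0 < V.
  by move=> Xi; apply: lt_le_trans Xi _; rewrite /V (bigD1 i) //= lerDl sumr_ge0.
have U0 i : 0 < x i -> 0 < U.
  move=> xi; apply: lt_le_trans (powR_gt0 q xi) _.
  by rewrite /U (bigD1 i) //= lerDl sumr_ge0 // => j _; rewrite powR_ge0.
have [i0 /andP[xi0 Xi0]|none] := pickP (fun i => (0 < x i) && (0 < X i)); last first.
  rewrite big1 // => i _; have := none i; rewrite !lt0r x0 X0 !andbT.
  by case: eqP => [->|_]; [rewrite mul0r | case: eqP => // ->; rewrite mulr0].
have {}U0 := U0 _ xi0; have {}V0 := V0 _ Xi0; have {}W0 := W0 _ Xi0.
have w : q^-1 + (1 - 2 / q) + q^-1 = 1 by field.
have v0 : 0 <= 1 - 2 / q by rewrite subr_ge0 ler_pdivrMr // mul1r.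
have key i : x i * X i <= U `^ q^-1 * V `^ (1 - 2 / q) * W `^ q^-1 *
    (q^-1 * (x i `^ q / U) + (1 - 2 / q) * (X i / V) + q^-1 * (X i ^+ 2 / W)).
  have [xi|] := ltP 0 (x i); last first.
    move=> h; have -> : x i = 0 by apply/le_anti; rewrite h x0.
    rewrite mul0r mulr_ge0 // !addr_ge0 // mulr_ge0 ?divr_ge0 ?exprn_ge0 ?powR_ge0 ?invr_ge0 //;
      exact: ltW.
  have [Xi|] := ltP 0 (X i); last first.
    move=> h; have -> : X i = 0 by apply/le_anti; rewrite h X0.
    rewrite mulr0 mulr_ge0 // !addr_ge0 // mulr_ge0 ?divr_ge0 ?exprn_ge0 ?powR_ge0 ?invr_ge0 //;
      exact: ltW.
  have qi0 : 0 <= q^-1 by rewrite invr_ge0 ltW.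
  apply: le_trans (ler_wpM2l rhs0 (weighted_amgm3 qi0 v0 w _ _ _));
    rewrite ?divr_gt0 ?powR_gt0 ?exprn_gt0 //.
  have E (y z e : R) : 0 < y -> 0 < z -> z `^ e * (y / z) `^ e = y `^ e.
    by move=> y0 z0; rewrite -powRM ?divr_ge0 ?ltW // mulrCA divff ?mulr1 ?gt_eqF.
  have -> (a b c a' b' c' : R) : a * b * c * (a' * b' * c') = (a * a') * (b * b') * (c * c').
    by ring.
  rewrite !E ?powR_gt0 ?exprn_gt0 // -powRrM mulfV // powRr1 // -powR_mulrn // -powRrM.
  rewrite -mulrA -powRD; last by rewrite (gt_eqF Xi) implybT.
  by have -> : 1 - 2 / q + 2 * q^-1 = 1; [field | rewrite powRr1].
apply: le_trans (ler_sum _ (fun i _ => key i)) _.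
rewrite -mulr_sumr -[leRHS]mulr1 ler_wpM2l // !big_split /= -!mulr_sumr -!mulr_suml.
by rewrite -/U -/V -/W !divff ?gt_eqF // !mulr1 w.
Qed.

End Hoelder.

(** * From the norm inequality to the theorem *)

Section Bound.
Import boot.fintype boot.finset.
Variable R : realType.

Lemma ffact_bin_fact n d k : (d <= k <= n)%N ->
  ((n - k)`! * 'C(n - d, k - d) * n ^_ d = 'C(n, k) * (n - k)`! * k ^_ d)%N.
Proof.
case/andP=> dk kn; have dn := leq_trans dk kn.
apply/eqP; rewrite -(eqn_pmul2r (fact_gt0 (k - d))); apply/eqP.
have e1 := ffact_fact dn; have e2 := ffact_fact dk; have e3 := bin_fact kn.
have := bin_fact (leq_sub2r d kn); rewrite subnBA // subnK // => e4.
have -> : ((n - k)`! * 'C(n - d, k - d) * n ^_ d * (k - d)`! =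
  n ^_ d * ('C(n - d, k - d) * ((k - d)`! * (n - k)`!)))%N by ring.
rewrite e4 e1 -e3 -e2; ring.
Qed.

(** The sum of [X s * |chi s|] is bounded below by the spreading of [chi] and above
   by [hoelder_sum_square]. *)
Lemma character_Lnorm_ge (q : R) n d (chi : 'CF([set: 'S_n])) : 2 <= q ->
  char_spread chi d -> exists m : nat,
  [/\ chi 1%g = m%:R, ('C(n - d, d) <= m)%N & forall k, (d <= k <= n)%N ->
   (m * k ^_ d)%N%:R <= character_Lnorm q chi * (k`! * 2 ^ k)%N%:R `^ q^-1 * (n ^_ d)%N%:R].
Proof.
move=> q2 [m [chi1 md spread]]; exists m; split=> // k dkn.
have /andP[dk kn] := dkn.
have q0 : 0 < q by lra.
pose x (s : 'S_n) : R := real_of_algC R `|chi s|.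
pose X (s : 'S_n) : R := 'C(#|fixpoints s|, k)%:R.
have x0 s : 0 <= x s by apply: real_of_algC_ge0.
pose a : R := ('C(n, k) * (n - k)`!)%N%:R.
have a0 : 0 < a by rewrite ltr0n muln_gt0 bin_gt0 kn fact_gt0.
have nfE : (n`!)%:R = a * (k`!)%:R.
  by rewrite -natrM -(bin_fact kn); congr (_%:R); ring.
have lower : ((n - k)`! * ('C(n - d, k - d) * m))%N%:R <= \sum_s x s * X s.
  rewrite -(@real_of_algC_nat R).
  have real_term s : `|chi s| *+ 'C(#|fixpoints s|, k) \is Num.real by rewrite rpredMn ?normr_real.
  apply: le_trans (real_of_algC_le _ _ _ (spread k dkn)) _.
  - exact: realn.
  - by apply: rpred_sum => s _.
  apply: le_trans (real_of_algC_sum_le _ real_term) _.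
  by apply: ler_sum => s _; rewrite /x /X mulr_natr real_of_algCMn_le ?normr_real.
have sumX : \sum_s X s = a.
  rewrite -natr_sum; congr (_%:R).
  have := sum_binom_fixpoints_perm_on [set: 'I_n] k; rewrite cardsT card_ord => <-.
  apply: eq_big => [s|s _]; first by rewrite /= perm_on_fixpoints setCT sub0set.
  by rewrite setTI.
have sumX2 : \sum_s X s ^+ 2 <= 2 ^+ k * a.
  under eq_bigr do rewrite -natrX.
  rewrite -natr_sum -natrX -natrM ler_nat.
  by have := sum_binom_fixpoints2 'I_n k; rewrite card_ord.
have := le_trans lower (hoelder_sum_square q2 x0 (fun s => ler0n _ _)).
rewrite sumX; set W := \sum_s _ => main.
have qi0 : 0 <= q^-1 by rewrite invr_ge0 ltW.
have NE : (\sum_s x s `^ q) `^ q^-1 = character_Lnorm q chi * (n`!)%:R `^ q^-1.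
  rewrite /character_Lnorm -powRM ?ler0n //.
    by rewrite mulrAC mulVf ?mul1r // pnatr_eq0 -lt0n fact_gt0.
  by rewrite mulr_ge0 ?invr_ge0 ?ler0n // sumr_ge0 // => s _; apply: powR_ge0.
have {}main : ((n - k)`! * ('C(n - d, k - d) * m))%N%:R <=
    character_Lnorm q chi * (k`! * 2 ^ k)%N%:R `^ q^-1 * a.
  apply: le_trans main _; rewrite NE.
  apply: (@le_trans _ _ (character_Lnorm q chi * (n`!)%:R `^ q^-1 * a `^ (1 - 2 / q) *
     (2 ^+ k * a) `^ q^-1)).
    rewrite ler_wpM2l ?mulr_ge0 ?powR_ge0 // ge0_ler_powR ?nnegrE //.
      by rewrite sumr_ge0 // => s _; rewrite exprn_ge0 ?ler0n.
    by rewrite mulr_ge0 ?exprn_ge0 ?ltW.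
  rewrite nfE natrM natrX !powRM ?mulr_ge0 ?exprn_ge0 ?ler0n ?(ltW a0) //.
  have aE : a `^ q^-1 * a `^ (1 - 2 / q) * a `^ q^-1 = a.
    rewrite -!powRD ?(gt_eqF a0) ?implybT //.
    have -> : q^-1 + (1 - 2 / q) + q^-1 = 1 by field; rewrite gt_eqF.
    by rewrite powRr1 // ltW.
  rewrite [leLHS](_ : _ = character_Lnorm q chi * ((k`!)%:R `^ q^-1 * (2 ^+ k) `^ q^-1) *
    (a `^ q^-1 * a `^ (1 - 2 / q) * a `^ q^-1)); first by rewrite aE.
  ring.
rewrite -(ler_pM2r a0).
have -> : (m * k ^_ d)%N%:R * a = ((n - k)`! * ('C(n - d, k - d) * m))%N%:R * (n ^_ d)%N%:R :> R.
  rewrite /a -!natrM; congr (_%:R).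
  have -> : (m * k ^_ d * ('C(n, k) * (n - k)`!) = m * ('C(n, k) * (n - k)`! * k ^_ d))%N by ring.
  rewrite -ffact_bin_fact //; ring.
by rewrite mulrAC ler_wpM2r ?ler0n.
Qed.

(** Factor by factor: [k * (d - i) <= d * (k - i)]. *)
Lemma expn_fact_le_ffact k d : (d <= k)%N -> (k ^ d * d`! <= d ^ d * k ^_ d)%N.
Proof.
have pw a : (a ^ d = \prod_(i < d) a)%N by rewrite prod_nat_const card_ord.
move=> dk; rewrite -ffactnn !ffact_prod (pw k) (pw d) -!big_split /=.
apply: leq_prod => i _; rewrite !mulnBr [(d * k)%N]mulnC leq_sub2l //.
by rewrite leq_mul2r dk orbT.
Qed.

Lemma ffact_le_expn k d : (k ^_ d <= k ^ d)%N.
Proof.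
rewrite ffact_prod (_ : k ^ d = \prod_(i < d) k)%N; last by rewrite prod_nat_const card_ord.
by apply: leq_prod => i _; rewrite leq_subr.
Qed.

(** [d ^ d <= (2 * d) ^_ d = 'C(2 * d, d) * d`!], and the binomial is at most
   [2 ^ (2 * d)]. *)
Lemma expn_self_le_fact d : (d ^ d <= 4 ^ d * d`!)%N.
Proof.
have bin4 : ('C(2 * d, d) <= 4 ^ d)%N.
  rewrite (_ : 4 = 2 ^ 2)%N // -expnM -[(2 * d)%N]card_ord -card_draws.
  by rewrite -[in leqRHS](cardsT 'I_(2 * d)) -card_powerset subset_leq_card // powersetT subsetT.
rewrite -(leq_pmul2r (fact_gt0 d)) -mulnA.
apply: leq_trans (_ : 'C(2 * d, d) * d`! * d`! <= _)%N; last by rewrite -mulnA leq_mul2r bin4 orbT.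
rewrite leq_mul2r bin_ffact; apply/orP; right.
rewrite ffact_prod (_ : d ^ d = \prod_(i < d) d)%N; last by rewrite prod_nat_const card_ord.
by apply: leq_prod => i _; rewrite mul2n -addnn -addnBA ?leq_addr // ltnW.
Qed.

Lemma expn_le_ffact k d : (d <= k)%N -> (k ^ d <= 4 ^ d * k ^_ d)%N.
Proof.
move=> dk; rewrite -(leq_pmul2r (fact_gt0 d)).
apply: leq_trans (expn_fact_le_ffact dk) _; rewrite mulnAC leq_mul2r.
by rewrite expn_self_le_fact orbT.
Qed.

Lemma expn_le_bin n d : (2 * d <= n)%N -> (n ^ d <= 2 ^ d * d ^ d * 'C(n - d, d))%N.
Proof.
move=> dn; have dnd : (d <= n - d)%N by lia.
apply: (@leq_trans (2 ^ d * (n - d) ^ d)%N).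
  rewrite -expnMn; case: (posnP d) => [->//|d0]; rewrite leq_exp2r //; lia.
rewrite -mulnA leq_mul2l -(leq_pmul2r (fact_gt0 d)) -mulnA bin_ffact.
by rewrite expn_fact_le_ffact ?orbT.
Qed.

(** Up to a constant, [k] is the larger of [q d / log(q d)] and [d].  In the first
   case [log(2k) <= log(q d)]; in the second the bound on [d] gives
   [log(2d) = O(q)]. *)
Lemma exists_number_fixpoints (q : R) (n d : nat) : 2 <= q -> (0 < d)%N ->
  d%:R < expR (ln 2 / 128 * q) -> d%:R * (q + 1) < n%:R ->
  exists k : nat, [/\ (d <= k <= n)%N,
    k%:R * ln (2 * k%:R) <= 2 * ln 2 * q * d%:R &
    ln 2 * q * d%:R <= 4 * ln (q * d%:R) * k%:R].
Proof.
move=> q2 d0 dq dn.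
have d1 : 1 <= d%:R :> R by rewrite ler1n.
have dn' : (d <= n)%N by rewrite -(ler_nat R); nra.
have l0 : 0 < ln 2 :> R by rewrite ln_gt0 // ltr1n.
have l1 : ln 2 <= 1 :> R.
  have := @le_ln1Dx R 1; rewrite (_ : 1 + 1 = 2) //; apply; lra.
have qd2 : 2 <= q * d%:R by nra.
have L0 : ln 2 <= ln (q * d%:R) by rewrite ler_ln // posrE; lra.
set L := ln (q * d%:R) in L0 *; set l := ln 2 in l0 l1 L0 *.
have Lpos : 0 < L by lra.
(* the factor [l / 2] in [t] makes [2 * t] at most [q * d] *)
pose t := l * q * d%:R / (2 * L).
have tE : t * (2 * L) = l * q * d%:R by rewrite /t divfK // mulf_neq0 ?gt_eqF //; lra.
have t0 : 0 <= t by rewrite divr_ge0 //; nra.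
have /andP[kt tk] := trunc_itv t0; set k := Num.trunc t in kt tk.
have tqd : 2 * t <= q * d%:R by nra.
have lnd : ln d%:R <= l / 128 * q.
  by rewrite -[leRHS]expRK ler_ln ?posrE ?expR_gt0 ?ltW //; lra.
have [dk|kd] := leqP d k.
  exists k; split.
  - by rewrite dk -(ler_nat R); nra.
  - have k1 : 1 <= k%:R :> R by rewrite ler1n (leq_trans d0).
    have lk : ln (2 * k%:R) <= L by rewrite ler_ln ?posrE //; lra.
    nra.
  - rewrite -tE; have k1 : 1 <= k%:R :> R by rewrite ler1n (leq_trans d0).
    have -> : 4 * L * k%:R = 2 * k%:R * (2 * L) by ring.
    rewrite -natr1 in tk; rewrite ler_pM2r; lra.
exists d; split; rewrite ?leqnn //.
  rewrite lnM ?posrE //; last lra.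
  rewrite -/l mulrC ler_pM2r; last lra.
  nra.
have td : t <= d%:R by apply: le_trans (ltW tk) _; rewrite ler_nat.
rewrite -tE; nra.
Qed.

Lemma powR_fact_le (q : R) (d k : nat) : 2 <= q -> (0 < k)%N ->
  k%:R * ln (2 * k%:R) <= 2 * ln 2 * q * d%:R ->
  (k`! * 2 ^ k)%N%:R `^ q^-1 <= 4 ^+ d :> R.
Proof.
move=> q2 k0 h; have q0 : 0 < q by lra.
have k0' : 0 < 2 * k%:R :> R by rewrite mulr_gt0 ?ltr0n.
have fk : (k`! <= k ^ k)%N by rewrite -ffactnn ffact_le_expn.
apply: (@le_trans _ _ (expR (2 * ln 2 * q * d%:R) `^ q^-1)).
  rewrite ge0_ler_powR ?nnegrE ?expR_ge0 ?ler0n ?invr_ge0 ?(ltW q0) //.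
  apply: (@le_trans _ _ ((2 * k%:R) ^+ k)).
    by rewrite -natrM -natrX ler_nat expnMn mulnC leq_mul2l fk orbT.
  by rewrite -[leLHS]lnK ?posrE ?exprn_gt0 // ler_expR lnXn // -(mulr_natl (ln _)).
rewrite -expRM (_ : _ * q^-1 = ln (4 ^+ d)); first by rewrite lnK // posrE exprn_gt0.
rewrite lnXn // (_ : 4 = 2 * 2 :> R); last by ring.
by rewrite lnM ?posrE // -mulr_natr; field; rewrite gt_eqF.
Qed.

(** The missing factor [y `^ (- 2 / q)] is at most [M `^ (2 / q) <= M]. *)
Lemma powR_le_scaled (q y M : R) : 2 <= q -> 0 < y -> 1 <= M -> 1 <= M * y ->
  y `^ (1 - 2 / q) <= M * y.
Proof.
move=> q2 y0 M1 My; have q0 : 0 < q by lra.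
rewrite powRD ?(gt_eqF y0) ?implybT // powRr1 ?(ltW y0) // [leRHS]mulrC ler_pM2l //.
have yi : y^-1 <= M by rewrite -[leLHS]mul1r ler_pdivrMr.
rewrite powRN -powR_inv1 ?powR_ge0 // -powRrM mulrC powRrM powR_inv1 ?(ltW y0) //.
apply: (@le_trans _ _ (M `^ (2 / q))).
  by rewrite ge0_ler_powR ?nnegrE ?divr_ge0 ?invr_ge0 ?(ltW q0) ?(ltW y0) //; lra.
rewrite -[leRHS]powRr1; last lra.
by rewrite ler_powR // ler_pdivrMr // mul1r.
Qed.

End Bound.

Theorem theorem1p14 (R : realType) :
  exists c : R, 0 < c /\
    forall (q : R) (n d : nat) (chi : 'CF([set: 'S_n])),
      2 <= q ->
      d%:R < Num.min (expR (c * q)) (n%:R / (q + 1)) ->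
      chi \in irr [set: 'S_n] ->
      has_level chi d ->
      (c * q / ln (q * d%:R)) ^+ d *
        (d%:R ^+ d * real_of_algC R (chi 1%g) / n%:R ^+ d) `^ (1 - 2 / q)
      <= character_Lnorm q chi.
Proof.
have l0 : 0 < ln 2 :> R by rewrite ln_gt0 // ltr1n.
exists (ln 2 / 128); split=> [|q n d chi q2 dlt chi_irr chi_d]; first by rewrite divr_gt0.
move: dlt; rewrite lt_min => /andP[dq dn].
have q1 : 0 < q + 1 by lra.
rewrite ltr_pdivlMr // in dn.
have [m [chi1 md lower]] := character_Lnorm_ge q2 (char_spread_level chi_irr chi_d).
rewrite chi1 real_of_algC_nat; set N := character_Lnorm q chi in lower *.
have N0 : 0 <= N by apply: powR_ge0.
have q0 : 0 < q by lra.
have e1 : 1 - 2 / q <= 1 by rewrite gerBl divr_ge0 ?ltW.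
have [d0|d0] := posnP d.
  rewrite d0 !expr0 !mul1r divr1.
  have m1 : (1 <= m)%N by move: md; rewrite d0 bin0.
  apply: (@le_trans _ _ m%:R).
    by rewrite -[leRHS]powRr1 ?ler0n // ler_powR // ler1n.
  have := lower 0%N; rewrite d0 leq0n => /(_ isT).
  by rewrite !ffactn0 !muln1 powR1 !mulr1.
have [k [dkn klog kL]] := exists_number_fixpoints q2 d0 dq dn.
have /andP[dk kn] := dkn; have k0 := leq_trans d0 dk.
have d1 : 1 <= d%:R :> R by rewrite ler1n.
have n0 : (0 < n)%N by apply: leq_trans k0 kn.
have dn2 : (2 * d <= n)%N by rewrite -(ler_nat R) natrM; nra.
have Z4 := powR_fact_le q2 k0 klog.
have nR : 0 < n%:R :> R by rewrite ltr0n.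
have dR : 0 < d%:R :> R by rewrite ltr0n.
have main : m%:R * k%:R ^+ d <= 16 ^+ d * N * n%:R ^+ d.
  apply: (@le_trans _ _ (4 ^+ d * (m * k ^_ d)%N%:R)).
    by rewrite natrM mulrCA ler_wpM2l ?ler0n // -!natrX -natrM ler_nat expn_le_ffact.
  (* one factor [4 ^+ d] for [k ^+ d / k ^_ d], one for [(k`! 2 ^ k) `^ q^-1] *)
  rewrite (_ : 16 = 4 * 4 :> R); last by ring.
  rewrite exprMn -!mulrA ler_wpM2l ?exprn_ge0 //; apply: le_trans (lower k dkn) _.
  rewrite [leRHS]mulrCA -mulrA ler_wpM2l // ler_pM ?powR_ge0 ?ler0n //.
  by rewrite -natrX ler_nat ffact_le_expn.
set y := (X in X `^ _).
have My : 1 <= 2 ^+ d * y.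
  rewrite /y !mulrA ler_pdivlMr ?exprn_gt0 // mul1r -!natrX -!natrM ler_nat.
  by apply: leq_trans (expn_le_bin dn2) _; rewrite leq_mul2l md orbT.
have M1 : 1 <= 2 ^+ d :> R by rewrite exprn_ege1 // ler1n.
have y0 : 0 < y by rewrite -(@pmulr_rgt0 _ (2 ^+ d)) ?exprn_gt0 //; lra.
have L0 : 0 < ln (q * d%:R) by rewrite ln_gt0 //; nra.
have base : ln 2 / 128 * q / ln (q * d%:R) <= k%:R / (32 * d%:R).
  by rewrite ler_pdivrMr // [leRHS]mulrAC ler_pdivlMr ?mulr_gt0 //; lra.
have base0 : 0 <= ln 2 / 128 * q / ln (q * d%:R) by rewrite !mulr_ge0 ?invr_ge0 ?ltW.
apply: (@le_trans _ _ ((k%:R / (32 * d%:R)) ^+ d * (2 ^+ d * y))).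
  rewrite ler_pM ?exprn_ge0 ?powR_ge0 ?powR_le_scaled //.
  by rewrite lerXn2r ?nnegrE // (le_trans base0).
rewrite mulrA -exprMn (_ : k%:R / _ * 2 = k%:R / (16 * d%:R)); last first.
  by field; rewrite gt_eqF.
rewrite expr_div_n exprMn /y mulrA ler_pdivrMr ?exprn_gt0 //.
rewrite mulrAC ler_pdivrMr ?mulr_gt0 ?exprn_gt0 //.
apply: le_trans (_ : d%:R ^+ d * (16 ^+ d * N * n%:R ^+ d) <= _); last first.
  by rewrite le_eqVlt; apply/orP; left; apply/eqP; ring.
by rewrite mulrCA ler_pM2l ?exprn_gt0 // [leLHS]mulrC.
Qed.
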